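(* Let $n$ be a positive integer and $i,k\in\{1,\ldots,n\}$. Let $H\sim\text{Hyp}(n,i,k)$ and $X\sim\text{Bin}(k,\frac{i}{n})$, and assume that: (1) $\frac{ik}{n}\in (m-1, m]$ for some integer $m\in \{2,3,\ldots, \min\{i,k\}-2\}$; (2) $\frac{(n-i)(n-k)}{n}> 1$. Then \[ \frac{\mathbb{P}(H=m)}{\mathbb{P}(X=m)} \,\ge\, \frac{e^{-1/8}}{2} \cdot \sqrt{\frac{i(n-i)(n-k)}{(i-m)(n-i-k+m)n}}. \]
   Context: $\text{Hyp}(n,i,k)$ denotes the hypergeometric distribution: the number of black marbles in a sample without replacement of size $k$ from an urn with $i$ black and $n-i$ white marbles, i.e. $\mathbb{P}(H=j)=\binom{i}{j}\binom{n-i}{k-j}/\binom{n}{k}$. $\text{Bin}(k,p)$ denotes the binomial distribution with $k$ trials and success probability $p$. *)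

(* Defs.v *)
(* Stdlib reals world; binomial coefficients from MathComp's 'C (nat-valued,
   which is 0 when the lower index exceeds the upper one). *)
From Stdlib Require Import Reals.
From mathcomp Require Import ssreflect ssrbool ssrnat binomial.

Open Scope R_scope.

(* P(H = j) for H ~ Hyp(n, i, k): sample of size k without replacement from an
   urn with i black and n - i white marbles. *)
Definition hyp_pmf (n i k j : nat) : R :=
  INR ('C(i, j) * 'C(n - i, k - j))%N / INR 'C(n, k).

Definition bin_pmf (k : nat) (p : R) (j : nat) : R :=
  INR 'C(k, j) * p ^ j * (1 - p) ^ (k - j).

(* Main.v *)
(* Write i = x + m, k = m + l and n = x + m + y + l, so that i - m = x and
   n - i - k + m = y.  With S(a) = (a! e^a / a^a)^2 / a, the squared ratio
   P(H = m) / P(X = m) factors exactly as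
     S(i) S(n-i) S(n-k) / (S(x) S(y) S(n)) * Q * ((1 + d/x)^x (1 - d/y)^y)^2,
   where Q is the quantity under the square root and d = m - ik/n lies in [0, 1].
   From 2 <= (2a+1) ln(1 + 1/a) <= 2 + 1/(6a(a+1)), S is nonincreasing and
   S(a) e^(-1/(6a)) is nondecreasing, so for x, y >= 2 the S-quotient is at least
   e^(-1/4).  Finally (1 + d/x)^x >= 1 + d and (1 - d/y)^y >= (1 - d/2)^2 bound
   the last factor below by ((1 + d)(1 - d/2)^2)^2 >= 1/4. *)

Require Import Defs.
From Stdlib Require Import Reals Lra Lia.
From mathcomp Require Import ssreflect ssrbool ssrnat binomial.
From mathcomp Require Import zify.
From Coquelicot Require Import Coquelicot.

Open Scope R_scope.

Lemma le_of_derive_ge0 (f df : R -> R) (a b : R) : a <= b ->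
  (forall x, a <= x <= b -> is_derive f x (df x)) ->
  (forall x, a <= x <= b -> 0 <= df x) -> f a <= f b.
Proof.
move=> le_ab f_df df_ge0.
have := MVT_gen f a b df; rewrite /= Rmin_left // Rmax_right //.
case=> [x x_ab | x x_ab | c [c_ab mvt]].
- by apply: f_df; lra.
- apply/continuity_pt_filterlim/ex_derive_continuous; exists (df x); exact: f_df.
- have := df_ge0 c c_ab; nra.
Qed.

Lemma ln_1p_ge (u : R) : 0 <= u -> 2 * u / (2 + u) <= ln (1 + u).
Proof.
move=> u_ge0; set f := fun x => ln (1 + x) - 2 * x / (2 + x).
suff : f 0 <= f u by rewrite /f !Rplus_0_r ln_1; lra.
apply: (le_of_derive_ge0 _ (fun x => x ^ 2 / ((1 + x) * (2 + x) ^ 2))) => // x [x_ge0 _].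
- by rewrite /f; auto_derive; [lra | field; lra].
- apply: Rdiv_le_0_compat; first exact: pow2_ge_0.
  by apply: Rmult_lt_0_compat; [lra | apply: pow_lt; lra].
Qed.

Lemma ln_1p_le (u : R) : 0 <= u ->
  ln (1 + u) <= 2 * u / (2 + u) + u ^ 3 / (6 * (1 + u) * (2 + u)).
Proof.
move=> u_ge0; set f := fun x => 2 * x / (2 + x) + x ^ 3 / (6 * (1 + x) * (2 + x)) - ln (1 + x).
suff : f 0 <= f u by rewrite /f !Rplus_0_r ln_1; lra.
apply: (le_of_derive_ge0 _ (fun x => x ^ 4 / (6 * (1 + x) ^ 2 * (2 + x) ^ 2))) => // x [x_ge0 _].
- by rewrite /f; auto_derive; [repeat split; nra | field; lra].
- apply: Rdiv_le_0_compat; first exact: pow_le.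
  by apply: Rmult_lt_0_compat; [apply: Rmult_lt_0_compat | ]; try apply: pow_lt; lra.
Qed.

Lemma exp_le_compat (x y : R) : x <= y -> exp x <= exp y.
Proof. by case=> [/exp_increasing/Rlt_le | ->] //; right. Qed.

Lemma INR_gt0 (a : nat) : (0 < a)%N -> 0 < INR a.
Proof. by move=> /ltP; apply: lt_0_INR. Qed.

Lemma INR_fact_gt0 (a : nat) : 0 < INR a`!.
Proof. exact/INR_gt0/fact_gt0. Qed.

Definition stirling_sq (a : nat) : R := (INR a`! * exp 1 ^ a / INR a ^ a) ^ 2 / INR a.

Lemma stirling_sq_gt0 (a : nat) : (0 < a)%N -> 0 < stirling_sq a.
Proof.
move=> /INR_gt0 a_pos.
apply/Rdiv_lt_0_compat/a_pos/pow_lt/Rdiv_lt_0_compat; last exact: pow_lt.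
by apply: Rmult_lt_0_compat; [exact: INR_fact_gt0 | exact/pow_lt/exp_pos].
Qed.

Lemma fact_sq_stirling (a : nat) : (0 < a)%N ->
  INR a`! ^ 2 = stirling_sq a * INR a * (INR a ^ a / exp 1 ^ a) ^ 2.
Proof.
move=> /INR_gt0 a_pos; have := pow_lt _ a (exp_pos 1); have := pow_lt _ a a_pos.
by rewrite /stirling_sq => ? ?; field; repeat split; lra.
Qed.

Lemma stirling_sq_succ (a : nat) : (0 < a)%N ->
  stirling_sq a.+1 = stirling_sq a * exp (2 - (2 * INR a + 1) * ln (1 + / INR a)).
Proof.
move=> /INR_gt0 a_pos.
have -> : 2 * INR a + 1 = INR (2 * a + 1) by rewrite plus_INR mult_INR /=; ring.
rewrite exp_plus exp_Ropp -[exp (_ * ln _)]/(Rpower _ _) Rpower_pow; last first.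
  by have := Rinv_0_lt_compat _ a_pos; lra.
have -> : 1 + / INR a = (INR a + 1) / INR a by field; lra.
have -> : exp 2 = exp 1 ^ 2 by rewrite /= Rmult_1_r -exp_plus; congr exp; ring.
have -> : (2 * a + 1 = a + a + 1)%N by lia.
rewrite /stirling_sq factS mult_INR -addn1 /Rdiv !(Rpow_mult_distr, pow_inv, pow_add).
rewrite plus_INR pow_1 /=.
have := INR_fact_gt0 a; have := pow_lt _ a (exp_pos 1).
have := pow_lt _ a a_pos; have : 0 < (INR a + 1) ^ a by apply: pow_lt; lra.
move=> *; field; repeat split; lra.
Qed.

Lemma stirling_sq_succ_le (a : nat) : (0 < a)%N -> stirling_sq a.+1 <= stirling_sq a.
Proof.
move=> a_gt0; have a_pos := INR_gt0 a a_gt0; have S_pos := stirling_sq_gt0 a a_gt0.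
have ln_ge : 2 <= ln (1 + / INR a) * (2 * INR a + 1).
  apply/Rle_div_l; first lra.
  have -> : 2 / (2 * INR a + 1) = 2 * / INR a / (2 + / INR a) by field; lra.
  exact/ln_1p_ge/Rlt_le/Rinv_0_lt_compat.
have /exp_le_compat : 2 - (2 * INR a + 1) * ln (1 + / INR a) <= 0 by lra.
by rewrite exp_0 stirling_sq_succ // => ?; nra.
Qed.

Lemma stirling_sq_succ_ge (a : nat) : (0 < a)%N ->
  stirling_sq a * exp (- / (6 * INR a)) <= stirling_sq a.+1 * exp (- / (6 * INR a.+1)).
Proof.
move=> a_gt0; have a_pos := INR_gt0 a a_gt0.
have ln_le : ln (1 + / INR a) * (2 * INR a + 1) <= 2 + / (6 * INR a) - / (6 * (INR a + 1)).
  apply/Rle_div_r; first lra.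
  apply: (Rle_trans _ _ _ (ln_1p_le _ (Rlt_le _ _ (Rinv_0_lt_compat _ a_pos)))).
  by right; field; lra.
rewrite stirling_sq_succ // Rmult_assoc -exp_plus S_INR.
apply/Rmult_le_compat_l/exp_le_compat; first exact/Rlt_le/stirling_sq_gt0.
lra.
Qed.

Lemma stirling_sq_le (a b : nat) : (0 < a <= b)%N -> stirling_sq b <= stirling_sq a.
Proof.
case/andP=> a_gt0 le_ab; rewrite -(subnKC le_ab).
have := decreasing_prop (fun j => stirling_sq (a + j)) 0 (b - a).
rewrite /= addn0; apply; last exact: le_0_n.
by move=> j; rewrite addnS; apply: stirling_sq_succ_le; lia.
Qed.

Lemma stirling_sq_ge (a b : nat) : (0 < a <= b)%N ->
  stirling_sq a * exp (- / (6 * INR a)) <= stirling_sq b.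
Proof.
case/andP=> a_gt0 le_ab; rewrite -(subnKC le_ab).
set g := fun j => stirling_sq (a + j) * exp (- / (6 * INR (a + j))).
have g_up : Un_growing g by move=> j; rewrite /g addnS; apply: stirling_sq_succ_ge; lia.
have := growing_prop g (b - a) 0 g_up (le_0_n _); rewrite /g addn0.
have b_pos : 0 < INR (a + (b - a)) by apply/INR_gt0/ltn_addr.
have /exp_le_compat : - / (6 * INR (a + (b - a))) <= 0.
  by have := Rinv_0_lt_compat (6 * INR (a + (b - a))); lra.
have := stirling_sq_gt0 (a + (b - a)) (ltn_addr _ a_gt0).
by rewrite exp_0 => *; nra.
Qed.

Lemma pow_1_sub_ge_cubic (t : R) (y : nat) : 0 <= t <= 1 ->
  1 - INR y * t + INR y * (INR y - 1) / 2 * t ^ 2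
    - INR y * (INR y - 1) * (INR y - 2) / 6 * t ^ 3 <= (1 - t) ^ y.
Proof.
move=> t01; elim: y => [|y IH]; first by rewrite /=; lra.
have cubic_ge0 : 0 <= INR y * (INR y - 1) * (INR y - 2).
  case: y {IH} => [|[|[|y]]]; rewrite ?S_INR /=; try lra.
  by have := pos_INR y; nra.
have : 0 <= INR y * (INR y - 1) * (INR y - 2) / 6 * t ^ 4.
  by apply: Rmult_le_pos; [lra | apply: pow_le; lra].
have : (1 - t) * (1 - INR y * t + INR y * (INR y - 1) / 2 * t ^ 2
    - INR y * (INR y - 1) * (INR y - 2) / 6 * t ^ 3) <= (1 - t) * (1 - t) ^ y.
  by apply: Rmult_le_compat_l; lra.
by rewrite S_INR /=; nra.
Qed.

Lemma pow_1_sub_div_ge (d : R) (y : nat) : (2 <= y)%N -> 0 <= d <= 1 ->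
  (1 - d / 2) ^ 2 <= (1 - d / INR y) ^ y.
Proof.
move=> y_ge2 d01; have Y_ge2 : 2 <= INR y by apply/(le_INR 2)/leP.
apply: Rle_trans (pow_1_sub_ge_cubic _ _ _); last first.
  by split; [apply: Rdiv_le_0_compat | apply/Rle_div_l]; lra.
set Y := INR y in Y_ge2 *.
have -> : 1 - Y * (d / Y) + Y * (Y - 1) / 2 * (d / Y) ^ 2
    - Y * (Y - 1) * (Y - 2) / 6 * (d / Y) ^ 3
  = (1 - d / 2) ^ 2 + d ^ 2 / (12 * Y ^ 2) * (Y ^ 2 - 4 + 2 * (Y - 1) * (Y - 2) * (1 - d)).
  by field; lra.
suff : 0 <= d ^ 2 / (12 * Y ^ 2) * (Y ^ 2 - 4 + 2 * (Y - 1) * (Y - 2) * (1 - d)) by lra.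
apply: Rmult_le_pos; first by apply: Rdiv_le_0_compat; nra.
have : 0 <= (Y - 1) * (Y - 2) * (1 - d) by repeat apply: Rmult_le_pos; lra.
nra.
Qed.

Lemma pow_shift_prod_ge (x y : nat) (d : R) : (0 < x)%N -> (2 <= y)%N -> 0 <= d <= 1 ->
  1 / 2 <= (1 + d / INR x) ^ x * (1 - d / INR y) ^ y.
Proof.
move=> /INR_gt0 X_pos y_ge2 d01.
have up : 1 + d <= (1 + d / INR x) ^ x.
  have := Rle_pow_lin (d / INR x) x (Rdiv_le_0_compat _ _ (proj1 d01) X_pos).
  by have -> : INR x * (d / INR x) = d by field; lra.
have down := pow_1_sub_div_ge d y y_ge2 d01.
apply: (Rle_trans _ ((1 + d) * (1 - d / 2) ^ 2)).
  have : 0 <= (1 - d) * (2 + 2 * d - d ^ 2) by apply: Rmult_le_pos; nra.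
  nra.
by apply: Rmult_le_compat => //; nra.
Qed.

Lemma INR_bin (a b : nat) : (b <= a)%N ->
  INR 'C(a, b) = INR a`! / (INR b`! * INR (a - b)`!).
Proof.
move=> le_ba; rewrite -(bin_fact le_ba) !mult_INR.
by field; split; apply/Rgt_not_eq/INR_fact_gt0.
Qed.

Section HypergeometricBinomialRatio.

Variables x m y l : nat.
Hypotheses (x_gt0 : (0 < x)%N) (y_gt0 : (0 < y)%N).

Local Notation i := (x + m)%N.
Local Notation k := (m + l)%N.
Local Notation n := (x + m + y + l)%N.

Lemma hyp_bin_ratio_fact :
  hyp_pmf n i k m / bin_pmf k (INR i / INR n) m =
  INR i`! * INR (y + l)`! * INR (x + y)`! * INR n ^ k /
    (INR x`! * INR y`! * INR n`! * INR i ^ m * INR (y + l) ^ l).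
Proof.
have n_pos : 0 < INR n by apply: INR_gt0; lia.
have i_pos : 0 < INR i by apply: INR_gt0; lia.
have yl_pos : 0 < INR (y + l) by apply: INR_gt0; lia.
rewrite /hyp_pmf /bin_pmf mult_INR !INR_bin; try lia.
have -> : 1 - INR i / INR n = INR (y + l) / INR n.
  by rewrite !plus_INR in n_pos *; field; lra.
have -> : (n - i = y + l)%N by lia.
have -> : (k - m = l)%N by lia.
have -> : (i - m = x)%N by lia.
have -> : (y + l - l = y)%N by lia.
have -> : (n - k = x + y)%N by lia.
rewrite /Rdiv !(Rpow_mult_distr, pow_inv, pow_add).
have := pow_lt _ m i_pos; have := pow_lt _ l yl_pos.
have := pow_lt _ m n_pos; have := pow_lt _ l n_pos.
have := INR_fact_gt0 => F_pos *.
by field; repeat split; apply: Rgt_not_eq => //; exact: F_pos.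
Qed.

Lemma hyp_bin_ratio_sq :
  (hyp_pmf n i k m / bin_pmf k (INR i / INR n) m) ^ 2 =
  stirling_sq i * stirling_sq (y + l) * stirling_sq (x + y) /
    (stirling_sq x * stirling_sq y * stirling_sq n) *
  (INR i * INR (y + l) * INR (x + y) / (INR x * INR y * INR n)) *
  ((INR i * INR (x + y) / (INR n * INR x)) ^ x *
   (INR (y + l) * INR (x + y) / (INR n * INR y)) ^ y) ^ 2.
Proof.
rewrite hyp_bin_ratio_fact /Rdiv !(Rpow_mult_distr, pow_inv).
rewrite !fact_sq_stirling; try lia.
rewrite /Rdiv !(Rpow_mult_distr, pow_inv, pow_add).
field; repeat split; try apply: pow_nonzero.
all: try exact/Rgt_not_eq/exp_pos.
all: try (apply/Rgt_not_eq/stirling_sq_gt0; lia).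
all: apply/not_0_INR; lia.
Qed.

Lemma stirling_sq_quot_ge : (2 <= x)%N -> (2 <= y)%N ->
  exp (- (1 / 8)) ^ 2 <= stirling_sq i * stirling_sq (y + l) * stirling_sq (x + y) /
                          (stirling_sq x * stirling_sq y * stirling_sq n).
Proof.
move=> x_ge2 y_ge2.
have shift_ge a b : (2 <= a <= b)%N -> exp (- (1 / 8)) <= stirling_sq b / stirling_sq a.
  move=> /andP [a_ge2 le_ab]; have A_ge2 : 2 <= INR a by apply/(le_INR 2)/leP.
  apply/Rle_div_r; first by apply: stirling_sq_gt0; lia.
  apply: Rle_trans (stirling_sq_ge a b _); last lia.
  rewrite Rmult_comm; apply/Rmult_le_compat_l/exp_le_compat.
    by apply/Rlt_le/stirling_sq_gt0; lia.
  suff : / (6 * INR a) <= / 8 by lra.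
  by apply: Rinv_le_contravar; lra.
have Sn_pos : 0 < stirling_sq n by apply: stirling_sq_gt0; lia.
have Sx_pos : 0 < stirling_sq x by apply: stirling_sq_gt0; lia.
have Sy_pos : 0 < stirling_sq y by apply: stirling_sq_gt0; lia.
have Sxy_ge : 1 <= stirling_sq (x + y) / stirling_sq n.
  by apply/Rle_div_r => //; rewrite Rmult_1_l; apply: stirling_sq_le; lia.
have -> : stirling_sq i * stirling_sq (y + l) * stirling_sq (x + y) /
            (stirling_sq x * stirling_sq y * stirling_sq n) =
          stirling_sq i / stirling_sq x * (stirling_sq (y + l) / stirling_sq y) *
            (stirling_sq (x + y) / stirling_sq n).
  by field; repeat split; apply: Rgt_not_eq.
have e_pos := exp_pos (- (1 / 8)).
have -> : exp (- (1 / 8)) ^ 2 = exp (- (1 / 8)) * exp (- (1 / 8)) * 1 by ring.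
apply: Rmult_le_compat => //; [by apply: Rmult_le_pos; lra | lra |].
by apply: Rmult_le_compat; try lra; apply: shift_ge; lia.
Qed.

Lemma hyp_bin_ratio_ge : (2 <= x)%N -> (2 <= y)%N ->
  0 <= INR m - INR i * INR k / INR n <= 1 ->
  exp (- (1 / 8)) / 2 * sqrt (INR i * INR (y + l) * INR (x + y) / (INR x * INR y * INR n))
    <= hyp_pmf n i k m / bin_pmf k (INR i / INR n) m.
Proof.
move=> x_ge2 y_ge2; set d := INR m - _ => d01.
have ratio_ge0 : 0 <= hyp_pmf n i k m / bin_pmf k (INR i / INR n) m.
  rewrite hyp_bin_ratio_fact; apply/Rlt_le/Rdiv_lt_0_compat;
  by repeat apply: Rmult_lt_0_compat; first [exact: INR_fact_gt0 | apply/pow_lt/INR_gt0; lia].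
set Q := (X in sqrt X).
have Q_ge0 : 0 <= Q.
  by apply/Rlt_le/Rdiv_lt_0_compat; repeat apply: Rmult_lt_0_compat; apply: INR_gt0; lia.
apply: Rsqr_incr_0_var => //; rewrite !Rsqr_pow2 hyp_bin_ratio_sq -/Q.
have X_pos : 0 < INR x by apply: INR_gt0.
have Y_pos : 0 < INR y by apply: INR_gt0.
have N_pos : 0 < INR x + INR m + INR y + INR l by rewrite -!plus_INR; apply: INR_gt0; lia.
have -> : INR i * INR (x + y) / (INR n * INR x) = 1 + d / INR x.
  by rewrite /d !plus_INR; field; lra.
have -> : INR (y + l) * INR (x + y) / (INR n * INR y) = 1 - d / INR y.
  by rewrite /d !plus_INR; field; lra.
have P_ge := pow_shift_prod_ge x y d x_gt0 y_ge2 d01.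
have S_ge := stirling_sq_quot_ge x_ge2 y_ge2.
have -> : (exp (- (1 / 8)) / 2 * sqrt Q) ^ 2 = exp (- (1 / 8)) ^ 2 * Q * (1 / 2) ^ 2.
  by rewrite Rpow_mult_distr pow2_sqrt //; field.
apply: Rmult_le_compat; [|exact: pow2_ge_0| exact: Rmult_le_compat_r | apply: pow_incr; lra].
by apply: Rmult_le_pos => //; exact: pow2_ge_0.
Qed.

End HypergeometricBinomialRatio.

Theorem lemma4 (n i k m : nat) :
  (1 <= n)%N ->
  (1 <= i <= n)%N -> (1 <= k <= n)%N ->
  (2 <= m)%N -> (m + 2 <= minn i k)%N ->
  INR m - 1 < INR i * INR k / INR n <= INR m ->
  (INR n - INR i) * (INR n - INR k) / INR n > 1 ->
  hyp_pmf n i k m / bin_pmf k (INR i / INR n) m >=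
    exp (- (1 / 8)) / 2 *
    sqrt (INR i * (INR n - INR i) * (INR n - INR k) /
          ((INR i - INR m) * (INR n - INR i - INR k + INR m) * INR n)).
Proof.
move=> n_ge1 _ _ _ /[!leq_min] /andP [m_le_i m_le_k] mean_near_m var_gt1.
have N_ge1 : 1 <= INR n by apply/(le_INR 1)/leP.
(* (n - i)(n - k)/n = n - i - k + ik/n, and ik/n <= m. *)
have ik_le_nm : (i + k + 2 <= n + m)%N.
  have : INR (i + k + 1) < INR (n + m).
    have : INR n - INR i - INR k + INR i * INR k / INR n =
           (INR n - INR i) * (INR n - INR k) / INR n by field; lra.
    by rewrite !plus_INR /=; lra.
  by move/INR_lt/ltP; lia.
have [x def_i] : exists x, i = (x + m)%N by exists (i - m)%N; lia.
have [l def_k] : exists l, k = (m + l)%N by exists (k - m)%N; lia.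
have [y def_n] : exists y, n = (x + m + y + l)%N by exists (n + m - i - k)%N; lia.
subst i k n; apply/Rle_ge.
have -> : INR (x + m + y + l) - INR (x + m) = INR (y + l) by rewrite !plus_INR; ring.
have -> : INR (x + m + y + l) - INR (m + l) = INR (x + y) by rewrite !plus_INR; ring.
have -> : INR (x + m) - INR m = INR x by rewrite !plus_INR; ring.
have -> : INR (y + l) - INR (m + l) + INR m = INR y by rewrite !plus_INR; ring.
by apply: hyp_bin_ratio_ge; lia || lra.
Qed.
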